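(* Fix $\alpha>1$. Consider the closed-loop system consisting of the state equation $\dot x(t)=f(x(t),u(t))$, $x(0)=x_0$, the output equation $y(t)=h(x(t))$, and the controller equation $$\dot u(t)=\Big(\frac{\partial g}{\partial u}(x(t),u(t))\Big)^{-1}\Big(\alpha\big(r(t+T)-\hat y(t+T)\big)+\dot r(t+T)-\frac{\partial g}{\partial x}(x(t),u(t))\,f(x(t),u(t))+\mathcal E_2(t)\Big),$$ where $\hat y(t+T)=g(x(t),u(t))$ and $\mathcal E_2(t)\in\mathbb R^m$ is an additive error. Let $\eta_2:=\limsup_{t\to\infty}\|\mathcal E_2(t)\|$. If the trajectory of the closed-loop system is nonsingular, then $$\limsup_{t\to\infty}\|r(t)-\hat y(t)\|\le\frac{\eta_2}{\alpha}.$$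
   Context: Setting: $x(t)\in\mathbb R^n$ is the state, $u(t)\in\mathbb R^m$ the control input, $y(t)\in\mathbb R^m$ the output, $r(t)\in\mathbb R^m$ the reference signal, and $T>0$ a fixed lookahead time. Standing assumptions. (1) $f:\mathbb R^n\times\mathbb R^m\to\mathbb R^n$ is continuously differentiable, and for every compact set $\Gamma\subset\mathbb R^m$ there is $K>0$ such that $\|f(x,u)\|\le K(\|x\|+1)$ for all $x\in\mathbb R^n$, $u\in\Gamma$; $h:\mathbb R^n\to\mathbb R^m$ is continuously differentiable. (2) $g:\mathbb R^n\times\mathbb R^m\to\mathbb R^m$ (the output predictor) is continuously differentiable in $(x,u)$. (3) $r(\cdot)$ is continuous and piecewise differentiable; equations containing $\dot r(t+T)$ are understood at those $t$ where this derivative exists. Notation. The predicted output is $\hat y(t+T):=g(x(t),u(t))$ for $t\ge0$, i.e. $\hat y(t)=g(x(t-T),u(t-T))$ for $t\ge T$. $\|\cdot\|$ is the Euclidean norm. A closed-loop trajectory (defined for all $t\ge 0$) is called nonsingular if the partial Jacobian $\frac{\partial g}{\partial u}(x(t),u(t))$ is nonsingular for every $t\ge0$. *)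

(* Defs.v *)
From HB Require Import structures.
From mathcomp Require Import all_boot all_order all_algebra.
From mathcomp Require Import all_classical all_reals all_analysis.

Set Implicit Arguments.
Unset Strict Implicit.
Unset Printing Implicit Defensive.

Import Order.TTheory GRing.Theory Num.Theory.
Import numFieldNormedType.Exports.

Local Open Scope classical_set_scope.
Local Open Scope ring_scope.

(* Vectors are row vectors.  The library Jacobian ['J f p] therefore acts on
   the right: the differential of [f] at [p] maps [v] to [v *m 'J f p], and
   ['J f p] is the transpose of the usual Jacobian matrix. *)

(* The library norm [`|v|] on matrices is the sup norm. *)
Definition enorm (R : realType) (n : nat) (v : 'rV[R]_n) : R :=
  Num.sqrt (\sum_(i < n) v ord0 i ^+ 2).

(* The second clause is continuity of [p |-> 'd f p] for the operator norm. *)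
Definition continuously_differentiable (R : realType) (V W : normedModType R)
    (f : V -> W) : Prop :=
  (forall p, differentiable f p) /\
  (forall p (e : R), 0 < e ->
     \forall q \near p, forall v, `|'d f q v - 'd f p v| <= e * `|v|).

Definition partial_x (R : realType) (n m k : nat)
    (g : 'rV[R]_n * 'rV[R]_m -> 'rV[R]_k) (x : 'rV[R]_n) (u : 'rV[R]_m) :
    'M[R]_(n, k) :=
  'J (fun x' => g (x', u)) x.

Definition partial_u (R : realType) (n m k : nat)
    (g : 'rV[R]_n * 'rV[R]_m -> 'rV[R]_k) (x : 'rV[R]_n) (u : 'rV[R]_m) :
    'M[R]_(m, k) :=
  'J (fun u' => g (x, u')) u.

(* Derivative of a signal defined for nonnegative times: the ordinary two-sided
   derivative at [t > 0], the right derivative at [t = 0]. *)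
Definition has_time_derivative (R : realType) (V : normedModType R)
    (w : R -> V) (t : R) (dw : V) : Prop :=
  (fun s => (s - t)^-1 *: (w s - w t)) @ within `[0, +oo[ (t^') --> dw.

(* Differentiable on [0, +oo) apart from finitely many points in each bounded
   interval. *)
Definition piecewise_differentiable (R : realType) (V : normedModType R)
    (w : R -> V) : Prop :=
  exists2 D : set R,
    (forall b : R, finite_set (D `&` `[0, b])) &
    (forall t : R, 0 < t -> ~ D t -> derivable w t 1).

(* Main.v *)
Require Import Defs.
From HB Require Import structures.
From mathcomp Require Import all_boot all_order all_algebra.
From mathcomp Require Import all_classical all_reals all_analysis.
From mathcomp Require Import ring lra.

Import Order.TTheory GRing.Theory Num.Theory.
Import numFieldNormedType.Exports.

Local Open Scope classical_set_scope.
Local Open Scope ring_scope.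

(** Let [e t := r (t + T) - g (x t, u t)].  The controller cancels the drift of
    [g] along the trajectory, so [e' = - alpha e - E2] wherever [r] is
    differentiable, hence off a locally finite set.  If [|E2| <= c] from time
    [a] on, then [expR (alpha t) * (|e t|^2 - (c / alpha)^2)] is continuous
    with a nonpositive derivative off that set, hence nonincreasing after [a];
    so [|e|^2] exceeds [(c / alpha)^2] by an exponentially small amount, for
    every [c] above the limit superior of [|E2|]. *)

(** * Monotonicity and derivatives along curves *)

(** Induction on the exceptional points: a point inside the interval splits it in two, and the
    values at the shared endpoint chain the two inequalities; a point outside is dropped. The base
    case is the usual monotonicity criterion. *)
Lemma le_of_derive_le0_off_seq (R : realType) (phi : R -> R) (s : seq R)
    (a b : R) : a <= b ->
  (forall t, a <= t <= b -> {for t, continuous phi}) ->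
  (forall t, a < t < b -> t \notin s ->
    exists2 d, is_derive t 1 phi d & d <= 0) ->
  phi b <= phi a.
Proof.
elim: s a b => [|d s IHs] a b leab cphi dphi.
  apply: (@ler0_derive1_le_cc _ phi a b) => //.
  - by move=> t /[!in_itv]/= tab; have [d dt _] := dphi t tab isT;
    exact: ex_derive.
  - move=> t /[!in_itv]/= tab; have [d dt d0] := dphi t tab isT.
    by rewrite derive1E derive_val.
  - by apply: continuous_in_subspaceT => t /[!inE]/= /[!in_itv]/= /cphi.
  - by rewrite in_itv/= lexx leab.
  - by rewrite in_itv/= lexx leab.
have [/andP[ad db]|dab] := boolP (a < d < b); last first.
  apply: IHs => // t tab ts; apply: dphi => //; rewrite inE negb_or ts andbT.
  by apply: contraNneq dab => <-.
apply: (@le_trans _ _ (phi d));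
  apply: IHs => [|t /andP[t1 t2]|t /andP[t1 t2] ts].
- exact: ltW.
- by apply: cphi; rewrite t2 (le_trans (ltW ad)).
- by apply: dphi; rewrite ?t2 ?(lt_trans ad)// inE negb_or gt_eqF.
- exact: ltW.
- by apply: cphi; rewrite t1 (le_trans t2) ?ltW.
- by apply: dphi; rewrite ?t1 ?(lt_trans t2)// inE negb_or lt_eqF.
Qed.

(** For [0 < t] the half-line is a neighborhood of [t], so restricting to it does not change the
    limit; the substitution [s = h + t] then yields the library's difference quotient. *)
Lemma has_time_derivative_is_derive (R : realType) (V : normedModType R)
    (w : R -> V) (t : R) (dw : V) :
  0 < t -> has_time_derivative w t dw -> is_derive t 1 w dw.
Proof.
move=> t0 wt.
have wt' : (fun s => (s - t)^-1 *: (w s - w t)) @ t^' --> dw.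
  apply: cvg_trans wt; apply: cvg_app => A; rewrite /within/= => tA.
  near=> s.
  have : s \in `[0, +oo[%classic -> A s by rewrite inE; near: s.
  apply; rewrite inE/= in_itv/= andbT; near: s.
  apply: nbhs_dnbhs; apply: filterS (lt_nbhsr t0) => z; exact: ltW.
have wt0 : (fun h => h^-1 *: ((w \o shift t) (h *: 1) - w t)) @ 0^' --> dw.
  have st : shift t @ 0^' --> t^'.
    move=> A tA; have t0t : shift t @ (0 : R) --> t.
      by rewrite -[X in _ --> X]add0r; apply: cvgD;
        [exact: cvg_id|exact: cvg_cst].
    apply: (@filterS _ (nbhs (0 : R)) _ _ _ _ (t0t _ tA)) => h hA h0; apply: hA.
    by rewrite /shift/= -subr_eq0 addrK.
  have := cvg_comp _ _ st wt'; apply: cvg_trans; apply: near_eq_cvg; near=> h.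
  by rewrite /= addrK /GRing.scale/= mulr1.
by apply: DeriveDef; [apply/cvg_ex; exists dw | exact/cvg_lim].
Unshelve. all: end_near.
Qed.

(** Chain rule with the direction split as [(dx, 0) + (0, du)]. Each partial Jacobian is the
    differential of [g] composed with an affine embedding such as [x' |-> (x', u t)], whose
    differential is [v |-> (v, 0)]. *)
Lemma is_derive_partials (R : realType) (n m k : nat)
    (g : 'rV[R]_n * 'rV[R]_m -> 'rV[R]_k) (x : R -> 'rV[R]_n)
    (u : R -> 'rV[R]_m) (t : R) (dx : 'rV[R]_n) (du : 'rV[R]_m) :
  differentiable g (x t, u t) -> is_derive t 1 x dx -> is_derive t 1 u du ->
  is_derive t 1 (fun s => g (x s, u s))
    (dx *m partial_x g (x t) (u t) + du *m partial_u g (x t) (u t)).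
Proof.
move=> dg [xt dxE] [ut duE].
move/derivable1_diffP in xt; move/derivable1_diffP in ut.
have dxu : differentiable (fun s => (x s, u s)) t by exact: differentiable_pair.
have dgc : differentiable (g \o (fun s => (x s, u s))) t.
  exact: differentiable_comp.
apply: DeriveDef; first exact/derivable1_diffP.
rewrite deriveE// diff_comp//=.
have dp : 'd (fun s => (x s, u s)) t 1 = (dx, du).
  by rewrite diff_pair// -!deriveE// dxE duE.
rewrite dp.
have -> : (dx, du) = (dx, 0) + (0, du) :> 'rV[R]_n * 'rV[R]_m.
  by rewrite /GRing.add/= /add_pair/= addr0 add0r.
rewrite linearD/= /partial_x /partial_u; congr (_ + _).
  have ix : is_diff (x t) (fun x' => (x', u t)) (fun v => (v, 0)).
    exact: is_diff_pair.
  have gx : differentiable (g \o (fun x' => (x', u t))) (x t).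
    exact: differentiable_comp.
  rewrite -deriveEjacobian// deriveE//.
  have -> := @diff_comp _ _ _ _ (fun x' => (x', u t)) g (x t) ex_diff dg.
  by rewrite /= diff_val.
have iu : is_diff (u t) (fun u' => (x t, u')) (fun v => (0, v)).
  exact: is_diff_pair.
have gu : differentiable (g \o (fun u' => (x t, u'))) (u t).
  exact: differentiable_comp.
rewrite -deriveEjacobian// deriveE//.
have -> := @diff_comp _ _ _ _ (fun u' => (x t, u')) g (u t) ex_diff dg.
by rewrite /= diff_val.
Qed.

Lemma is_derive_coord (R : realType) (m n : nat) (e : R -> 'M[R]_(m, n))
    (t : R) (de : 'M[R]_(m, n)) (i : 'I_m) (j : 'I_n) :
  is_derive t 1 e de -> is_derive t 1 (fun s => e s i j) (de i j).
Proof.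
move=> [/cvg_ex[l el] eE].
have lE : l = de by rewrite -eE; apply/esym/cvg_lim.
rewrite -{}lE {eE}.
have ec :
    (fun h => h^-1 *: (((fun s => e s i j) \o shift t) (h *: 1) - e t i j))
    @ 0^' --> l i j.
  have := cvg_comp _ _ el (@coord_continuous _ _ _ i j l).
  apply: cvg_trans; apply: near_eq_cvg; near=> h.
  by rewrite /= !mxE.
by apply: DeriveDef; [apply/cvg_ex; exists (l i j) | exact/cvg_lim].
Unshelve. all: end_near.
Qed.

(** * Exponential decay of the error *)

Lemma sqr_enorm (R : realType) (n : nat) (v : 'rV[R]_n) :
  enorm v ^+ 2 = \sum_(i < n) v ord0 i ^+ 2.
Proof. by rewrite sqr_sqrtr// sumr_ge0// => i _; exact: sqr_ge0. Qed.

(** The squared norm [q] is used because the norm itself need not be differentiable where [e]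
    vanishes. Off [s] it satisfies [q' <= - alpha (q - (c / alpha)^2)], which makes the weighted
    quantity [phi] nonincreasing. *)
Lemma enorm_decay (R : realType) (m : nat) (e E : R -> 'rV[R]_m) (s : seq R)
    (alpha c a b : R) : 0 < alpha -> a <= b ->
  (forall t, a <= t <= b -> {for t, continuous e}) ->
  (forall t, a < t < b -> t \notin s ->
    is_derive t 1 e (- (alpha *: e t) - E t)) ->
  (forall t, a < t < b -> enorm (E t) <= c) ->
  enorm (e b) ^+ 2 <= (c / alpha) ^+ 2
    + expR (- (alpha * (b - a))) * enorm (e a) ^+ 2.
Proof.
move=> alpha0 leab ce de Ec.
pose q t := \sum_(i < m) e t ord0 i ^+ 2.
pose phi t := expR (alpha * t) * (q t - (c / alpha) ^+ 2).
have phiab : phi b <= phi a.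
  apply: (@le_of_derive_le0_off_seq _ phi s) => // t tab.
    have ct := ce t tab.
    apply: cvgM.
      apply: continuous_comp; last exact: continuous_expR.
      by apply: cvgM; [exact: cvg_cst|exact: cvg_id].
    apply: cvgB; last exact: cvg_cst.
    apply: cvg_big => [|i _]; first exact: add_continuous.
    have cti : e x ord0 i @[x --> t] --> e t ord0 i.
      exact: (cvg_comp _ _ ct (@coord_continuous _ _ _ ord0 i (e t))).
    by rewrite expr2; under eq_fun do rewrite expr2; exact: cvgM.
  move=> ts; have det := de t tab ts.
  pose dq :=
    \sum_(i < m) 2 * e t ord0 i * (- (alpha * e t ord0 i) - E t ord0 i).
  have qt : is_derive t 1 q dq.
    rewrite (_ : q = \sum_(i < m) (fun t => e t ord0 i) ^+ 2); last first.
      by apply/funext => z; rewrite fct_sumE.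
    apply: is_derive_sum => i.
    have di := @is_derive_coord _ _ _ _ _ _ ord0 i det.
    by apply: is_derive_eq; rewrite !mxE expr1.
  have xt :
      is_derive t 1 (fun t => expR (alpha * t)) (alpha * expR (alpha * t)).
    rewrite mulrC; apply: (@is_derive1_comp _ expR (fun t => alpha * t)).
    by apply: is_derive_eq; rewrite /GRing.scale/= mulr1.
  exists (expR (alpha * t) * dq
      + (q t - (c / alpha) ^+ 2) * (alpha * expR (alpha * t))).
    have qct : is_derive t 1 (q - cst ((c / alpha) ^+ 2)) dq.
      by apply: is_derive_eq; rewrite subr0.
    exact: (is_deriveM xt qct).
  rewrite [X in _ + X](_ : _ =
    expR (alpha * t) * (alpha * (q t - (c / alpha) ^+ 2))); last by ring.
  (* With the exponential factored out, it remains to show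
     [dq + alpha (q t - (c / alpha)^2) <= 0]. *)
  rewrite -mulrDr pmulr_rle0 ?expR_gt0//.
  (* AM-GM: [- 2 e E <= alpha e^2 + E^2 / alpha] *)
  have dqle : dq <= - (alpha * q t) + alpha^-1 * enorm (E t) ^+ 2.
    rewrite sqr_enorm /dq /q !mulr_sumr -sumrN -big_split/=.
    apply: ler_sum => i _.
    rewrite -subr_ge0.
    rewrite [leRHS](_ : _ = alpha * (e t ord0 i + alpha^-1 * E t ord0 i) ^+ 2).
      by rewrite mulr_ge0 ?sqr_ge0// ltW.
    by field; rewrite gt_eqF.
  have Ele : alpha^-1 * enorm (E t) ^+ 2 <= alpha^-1 * c ^+ 2.
    apply: ler_wpM2l; first by rewrite invr_ge0 ltW.
    rewrite ler_sqr ?nnegrE ?sqrtr_ge0 ?Ec//.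
    (* The sign of [c], needed to compare squares, comes from the bound on [E] at this very [t]. *)
    exact: le_trans (sqrtr_ge0 _) (Ec t tab).
  have -> : alpha * (q t - (c / alpha) ^+ 2) = alpha * q t - alpha^-1 * c ^+ 2.
    by field; rewrite gt_eqF.
  by lra.
(* Dividing by [expR (alpha * b)] leaves an extra term [- X * (c / alpha)^2] on the right, which is
   nonpositive and is discarded. *)
move: phiab; rewrite /phi !sqr_enorm -/(q a) -/(q b).
rewrite -ler_pdivlMl ?expR_gt0// -expRN mulrA -expRD.
rewrite (_ : - (alpha * b) + alpha * a = - (alpha * (b - a))); last by ring.
set X := expR _; have : 0 < X by exact: expR_gt0.
have := sqr_ge0 (c / alpha); nra.
Qed.

(** * Limits superior, and signals on the half-line *)

Lemma limf_esup_le_near (R : realType) (T : choiceType) (X : filteredType T)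
    (G : set_system X) (F : X -> \bar R) (z : \bar R) :
  (\forall t \near G, (F t <= z)%E) -> (limf_esup F G <= z)%E.
Proof.
move=> Fz; rewrite limf_esupE.
apply: (@le_trans _ _ (ereal_sup [set F t | t in [set t | (F t <= z)%E]])).
  by apply: ereal_inf_lbound; eexists; first exact: Fz.
by apply: ge_ereal_sup => _ [t tz <-].
Qed.

(** The limit superior is an infimum of suprema over sets of the filter, so a strict bound on it is
    already attained by the supremum over one such set. *)
Lemma near_lt_limf_esup (R : realType) (T : choiceType) (X : filteredType T)
    (G : set_system X) (F : X -> \bar R) (z : \bar R) : Filter G ->
  (limf_esup F G < z)%E -> \forall t \near G, (F t < z)%E.
Proof.
move=> FG; rewrite limf_esupE => /ereal_inf_lt[_ [A yA <-] Az].
apply: filterS yA => t At; apply: le_lt_trans Az.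
by apply: ereal_sup_ubound; exists t.
Qed.

(** Continuity passes to the smaller set []0, +oo[], which is open, and there subspace continuity is
    ordinary continuity. *)
Lemma within_ge0_continuous_at (R : realType) (V : topologicalType) (w : R -> V)
    (t : R) : {within `[0, +oo[%classic, continuous w} -> 0 < t ->
  {for t, continuous w}.
Proof.
move=> wc t0; have : {within `]0, +oo[%classic, continuous w}.
  by apply: continuous_subspaceW wc => s /=;
    rewrite !in_itv/= !andbT; exact: ltW.
rewrite continuous_open_subspace; last exact: interval_open.
by apply; rewrite inE/= in_itv/= andbT.
Qed.

Lemma is_derive_shift (R : realType) (V : normedModType R) (w : R -> V)
    (t c : R) (dw : V) :
  is_derive (t + c) 1 w dw -> is_derive t 1 (fun s => w (s + c)) dw.
Proof.
have quotE :
    (fun h => h^-1 *: (((fun s => w (s + c)) \o shift t) (h *: 1) - w (t + c)))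
    = (fun h => h^-1 *: ((w \o shift (t + c)) (h *: 1) - w (t + c))) :> (R -> V).
  by apply/funext => h /=; rewrite addrA.
by move=> [wd wE]; apply: DeriveDef; rewrite ?/derivable ?/derive quotE.
Qed.

Theorem proposition3p4 (R : realType) (n m : nat) (T : R) (T_gt0 : 0 < T)
  (f : 'rV[R]_n * 'rV[R]_m -> 'rV[R]_n)
  (f_C1 : continuously_differentiable f)
  (f_growth : forall Gamma : set 'rV[R]_m, compact Gamma ->
    exists2 K : R, 0 < K &
      forall (p : 'rV[R]_n) (v : 'rV[R]_m), Gamma v ->
        enorm (f (p, v)) <= K * (enorm p + 1))
  (h : 'rV[R]_n -> 'rV[R]_m)
  (h_C1 : continuously_differentiable h)
  (g : 'rV[R]_n * 'rV[R]_m -> 'rV[R]_m)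
  (g_C1 : continuously_differentiable g)
  (r : R -> 'rV[R]_m)
  (r_cont : {within `[0, +oo[%classic, continuous r})
  (r_diff : piecewise_differentiable r)
  (alpha : R) (alpha_gt1 : 1 < alpha)
  (x0 : 'rV[R]_n) (E2 : R -> 'rV[R]_m)
  (x : R -> 'rV[R]_n) (u y yhat : R -> 'rV[R]_m)
  (yhat_def : forall t : R, 0 <= t -> yhat (t + T) = g (x t, u t))
  (x_init : x 0 = x0)
  (state_eq : forall t : R, 0 <= t -> has_time_derivative x t (f (x t, u t)))
  (output_eq : forall t : R, 0 <= t -> y t = h (x t))
  (u_cont : {within `[0, +oo[%classic, continuous u})
  (controller_eq : forall t : R, 0 <= t -> derivable r (t + T) 1 ->
    has_time_derivative u t
      ((alpha *: (r (t + T) - yhat (t + T)) + 'D_1 r (t + T)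
        - f (x t, u t) *m partial_x g (x t) (u t) + E2 t)
       *m invmx (partial_u g (x t) (u t))))
  (nonsingular : forall t : R, 0 <= t -> partial_u g (x t) (u t) \in unitmx) :
  let eta2 : \bar R := limf_esup (fun t : R => (enorm (E2 t))%:E) +oo%R in
  (limf_esup (fun t : R => (enorm (r t - yhat t))%:E) +oo%R <= eta2 / alpha%:E)%E.
Proof.
cbv zeta; set eta2 := limf_esup (fun t => (enorm (E2 t))%:E) _.
pose e (t : R) := r (t + T) - g (x t, u t).
have x_der (t : R) : 0 < t -> is_derive t 1 x (f (x t, u t)).
  by move=> t0; apply: has_time_derivative_is_derive => //; exact/state_eq/ltW.
have e_cont (t : R) : 0 < t -> {for t, continuous e}.
  move=> t0; apply: cvgB.
    apply: (@cvg_comp _ _ _ (fun s => s + T) r _ (nbhs (t + T))).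
      by apply: cvgD; [exact: cvg_id|exact: cvg_cst].
    by apply: within_ge0_continuous_at => //; exact: addr_gt0.
  apply: (@cvg_comp _ _ _ (fun s => (x s, u s)) g _ (nbhs (x t, u t))).
    apply: (@cvg_pair _ _ _ (nbhs t) (nbhs (x t)) (nbhs (u t)) _ _ _ x u).
      have [xd _] := x_der t t0.
      exact/differentiable_continuous/derivable1_diffP.
    exact: within_ge0_continuous_at.
  exact: (differentiable_continuous (g_C1.1 (x t, u t))).
have e_der (t : R) : 0 < t -> derivable r (t + T) 1 ->
    is_derive t 1 e (- (alpha *: e t) - E2 t).
  move=> t0 rd.
  have u_der := has_time_derivative_is_derive _ _ _ _ _ t0
    (controller_eq _ (ltW t0) rd).
  have g_der := is_derive_partials _ _ _ _ _ _ _ _ _ _ (g_C1.1 _)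
    (x_der t t0) u_der.
  have rT_der : is_derive t 1 (fun s => r (s + T)) ('D_1 r (t + T)).
    by apply: is_derive_shift; exact: derivableP.
  apply: is_derive_eq (is_deriveB rT_der g_der) _.
  (* Nonsingularity cancels [invmx] against [partial_u]; then the drift through [partial_x] and the
     term ['D_1 r (t + T)] cancel. *)
  rewrite mulmxKV ?nonsingular ?ltW// yhat_def ?ltW// -/(e t).
  rewrite [X in _ - X]addrA [X in _ - (X + _)]addrC subrK.
  by rewrite [X in _ - (X + _)]addrC -addrA opprD addrA subrr add0r opprD.
have [D Dfin Dder] := r_diff.
(* The exceptional times of [e] are those of [r] moved back by [T]; on []0, b[] they come from the
   finitely many points of [D] in [[0, b + T]]. *)
have exc b : exists s : seq R, forall t, 0 < t < b -> t \notin s ->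
    derivable r (t + T) 1.
  have /finite_seqP[s sE] := Dfin (b + T).
  exists (map (fun d => d - T) s) => t /andP[t0 tb] ts.
  apply: Dder => [|DtT]; first exact: addr_gt0.
  move/negP: ts; apply; apply/mapP; exists (t + T); last by rewrite addrK.
  have : [set` s] (t + T).
    by rewrite -sE; split => //=;
      rewrite in_itv/= lerD2r (ltW tb) andbT addr_ge0 ?ltW.
  by [].
have alpha0 : 0 < alpha by exact: lt_trans alpha_gt1.
have eta2_ge0 : (0 <= eta2)%E.
  apply: limf_esup_ge0 => [|t]; last by rewrite lee_fin sqrtr_ge0.
  exact: filter_not_empty.
(* This is recorded before the case analysis, which forgets that [eta2] is a limit superior. *)
have E2_near (z : \bar R) : (eta2 < z)%E ->
    \forall t \near +oo, ((enorm (E2 t))%:E < z)%E.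
  exact: near_lt_limf_esup.
(* The value [-oo] contradicts nonnegativity, and for [+oo] the right-hand side is [+oo]. *)
case: eta2 eta2_ge0 E2_near => [eta| |]//; last first.
  by move=> *; rewrite inver gt_eqF// gt0_mulye ?leey// lte_fin invr_gt0.
rewrite lee_fin => eta_ge0 E2_near.
apply/lee_addgt0Pr => eps eps0.
rewrite inver gt_eqF// -EFinM -EFinD.
have eps2 : 0 < eps / 2 by rewrite divr_gt0.
(* Half of [eps] goes into [c / alpha = eta / alpha + eps / 2]; the other half is kept for the
   decaying transient. *)
pose c := eta + alpha * (eps / 2).
have c0 : 0 <= c by rewrite addr_ge0// mulr_ge0// ltW.
have [t0 [_ E2_lt]] : \forall t \near +oo, ((enorm (E2 t))%:E < c%:E)%E.
  by apply: E2_near; rewrite lte_fin ltrDl mulr_gt0.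
(* Adding 1 makes [a] strictly larger than both [t0] and 0: the bound on [E2] holds from [a] on, and
   [e] is continuous there. *)
pose a := Num.max t0 0 + 1.
have a_gt0 : 0 < a by rewrite ltr_wpDl// le_max lexx orbT.
have t0a : t0 < a by rewrite ltr_pwDr// le_max lexx.
pose Q := enorm (e a) ^+ 2.
have Q0 : 0 <= Q by exact: sqr_ge0.
have decay b : a <= b -> enorm (e b) ^+ 2 <= (c / alpha) ^+ 2
    + expR (- (alpha * (b - a))) * Q.
  move=> ab; have [s sP] := exc b.
  apply: (@enorm_decay R m e E2 s) => // t /andP[at_ tb].
  - by apply: e_cont; exact: lt_le_trans at_.
  - move=> ts; have t_gt0 := lt_trans a_gt0 at_.
    by apply: e_der => //; apply: sP; rewrite ?t_gt0.
  - by rewrite ltW// -lte_fin; apply: E2_lt; exact: lt_trans at_.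
apply: limf_esup_le_near; near=> t.
have tT : a + Q / (alpha * (eps / 2) ^+ 2) <= t - T.
  by rewrite lerBrDr; near: t; apply: nbhs_pinfty_ge; exact: num_real.
have at_ : a <= t - T.
  by apply: le_trans tT; rewrite lerDl divr_ge0// mulr_ge0 ?sqr_ge0// ltW.
have -> : r t - yhat t = e (t - T).
  by rewrite /e -yhat_def ?subrK// (le_trans (ltW a_gt0)).
(* [expR z >= 1 + z] makes the remaining term at most [(eps / 2) ^+ 2] as soon
   as [alpha * (t - T - a) >= Q / (eps / 2) ^+ 2]. *)
have small : expR (- (alpha * (t - T - a))) * Q <= (eps / 2) ^+ 2.
  rewrite expRN ler_pdivrMl ?expR_gt0//.
  have zQ : Q <= alpha * (t - T - a) * (eps / 2) ^+ 2.
    move: tT; rewrite -lerBrDl ler_pdivrMr ?mulr_gt0 ?exprn_gt0//.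
    by rewrite mulrCA mulrA.
  apply: (le_trans zQ); rewrite ler_wpM2r ?sqr_ge0//.
  by apply: le_trans (expR_ge1Dx _); rewrite lerDr.
have ca : c / alpha = eta / alpha + eps / 2.
  by rewrite /c; field; rewrite gt_eqF.
have ca0 : 0 <= c / alpha by rewrite divr_ge0// ltW.
have -> : eta / alpha + eps = c / alpha + eps / 2 by rewrite ca -addrA -splitr.
(* After squaring, [(c / alpha)^2 + (eps / 2)^2] is at most the square of the sum, since the cross
   term is nonnegative. *)
rewrite lee_fin -ler_sqr ?nnegrE ?sqrtr_ge0 ?addr_ge0 ?(ltW eps2)//.
apply: le_trans (decay _ at_) _; rewrite sqrrD.
have := mulr_ge0 ca0 (ltW eps2); move: small; rewrite mulr2n; lra.
Unshelve. all: end_near.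
Qed.
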